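(* Let $n \ge 2$ be an integer. Up to congruence, there is a unique triangle $H$ that belongs to an $n$-sociable Heronian cycle and whose perimeter is strictly greater than its area, namely the triangle with side lengths $3, 25, 26$. Moreover, each $n$-sociable Heronian cycle $H_1, \dots, H_n$ is composed only of copies of the amicable pair $(9,12,15), (3,25,26)$ and of the triangle $(9,10,17)$; that is, every $H_i$ is (up to congruence) one of the triangles $(9,12,15)$, $(3,25,26)$, $(9,10,17)$, and the triangles $(9,12,15)$ and $(3,25,26)$ occur in the cycle only in consecutive pairs: with indices taken modulo $n$, $H_i$ is the triangle $(9,12,15)$ if and only if $H_{i+1}$ is the triangle $(3,25,26)$.
   Context: A Heronian triangle is a (non-degenerate) triangle with integer side lengths and integer area. A Heronian triangle is equable if its area equals its perimeter. Triangles are described by their unordered side lengths, e.g. $(3,25,26)$. An $n$-sociable Heronian cycle is a sequence $H_1, H_2, \dots, H_n$ of Heronian triangles (repetitions allowed), at least one of which is not equable, such that $A_1 = p_2,\ A_2 = p_3,\ \dots,\ A_{n-1} = p_n,\ A_n = p_1$, where $A_i$ and $p_i$ denote the area and the perimeter of $H_i$. The amicable pair is the pair of triangles $(9,12,15)$ (perimeter $36$, area $54$) and $(3,25,26)$ (perimeter $54$, area $36$), which form a $2$-sociable Heronian cycle. *)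

(* Defs.v *)
From mathcomp Require Import all_boot all_order all_algebra.
From mathcomp Require Import reals.
Set Implicit Arguments.
Unset Strict Implicit.
Unset Printing Implicit Defensive.
Import Order.TTheory GRing.Theory Num.Theory.
Local Open Scope ring_scope.

(* Euclidean distance; the norm that the library puts on R * R is the sup norm. *)
Definition dist (R : realType) (P Q : R * R) : R :=
  Num.sqrt ((P.1 - Q.1) ^+ 2 + (P.2 - Q.2) ^+ 2).

(* Possibly degenerate: non-collinearity is required in [heronian]. *)
Record triangle (R : realType) : Type :=
  Triangle { vertA : R * R; vertB : R * R; vertC : R * R }.

Definition vertices (R : realType) (T : triangle R) : seq (R * R) :=
  [:: vertA T; vertB T; vertC T].

Definition side_lengths (R : realType) (T : triangle R) : seq R :=
  [:: dist (vertB T) (vertC T); dist (vertC T) (vertA T);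
      dist (vertA T) (vertB T)].

Definition perimeter (R : realType) (T : triangle R) : R :=
  \sum_(l <- side_lengths T) l.

(* Half the absolute value of the determinant of the vectors AB and AC. *)
Definition area (R : realType) (T : triangle R) : R :=
  `| ((vertB T).1 - (vertA T).1) * ((vertC T).2 - (vertA T).2)
     - ((vertC T).1 - (vertA T).1) * ((vertB T).2 - (vertA T).2) | / 2.

(* The vertices are not collinear. *)
Definition nondegenerate (R : realType) (T : triangle R) : Prop :=
  area T != 0.

Definition congruent (R : realType) (T U : triangle R) : Prop :=
  exists f : R * R -> R * R,
    (forall P Q, dist (f P) (f Q) = dist P Q) /\
    perm_eq (map f (vertices T)) (vertices U).

(* [perm_eq]: side lengths are unordered. *)
Definition has_sides (R : realType) (T : triangle R) (a b c : R) : Prop :=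
  perm_eq (side_lengths T) [:: a; b; c].

Definition heronian (R : realType) (T : triangle R) : Prop :=
  [/\ nondegenerate T,
      {in side_lengths T, forall l, l \is a Num.int}
    & area T \is a Num.int].

Definition equable (R : realType) (T : triangle R) : Prop :=
  area T = perimeter T.

(* [ordS i] is the cyclic successor of i, so the last area equals the first
   perimeter. *)
Definition sociable_cycle (R : realType) (n : nat) (H : 'I_n -> triangle R) :
    Prop :=
  [/\ forall i, heronian (H i),
      exists i, ~ equable (H i)
    & forall i, area (H i) = perimeter (H (ordS i))].

Definition in_sociable_cycle (R : realType) (n : nat) (T : triangle R) : Prop :=
  exists H : 'I_n -> triangle R, sociable_cycle H /\ exists i, H i = T.

(* Main.v *)
(* All perimeters and areas in a sociable cycle are multiples of 6, so that a cycle is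
   a closed walk s_1, s_2, ... on the integers perimeter / 6. With tangent lengths
   x <= y <= z, a step s -> r satisfies x + y + z = 3 s and x y z s = 12 r^2.
   Consider the maximum M of a non-constant cycle and a step M -> N with N < M.
   If M > 60, then (x, y) is (1, 2) or (1, 3), that is, M (M - 1) = 2 N^2 or
   M (3 M - 4) = 4 N^2, two Pell equations. The next step N -> N' must satisfy N' <= M,
   which bounds x y by 8 and gives one of finitely many equations: N times a linear form
   in N is a constant times a square. By the first Pell equation N = a b with
   a^2 - 2 b^2 = 1 or -1, and the square classes of a and b exclude all cases but one,
   (x, y) = (1, 8), after which N' is divisible by 3 but not by 9 and nothing
   but a step above M can follow. In the second family only (x, y) = (1, 2) can follow,
   which is excluded by Fermat descent on n (n + 1) = 3 g^4.
   The finitely many descents with M <= 60 leave only the cycle 6 -> 9 -> 6. *)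

Require Import Defs.
From Stdlib Require Import NArith.
From mathcomp Require Import all_boot all_order all_algebra.
From mathcomp Require Import reals.
From mathcomp Require Import ring lra zify.
Set Implicit Arguments.
Unset Strict Implicit.
Unset Printing Implicit Defensive.

(** * Squares and Pell equations *)

Lemma coprime_mul_sq m n r : coprime m n -> m * n = r * r ->
  exists e f, [/\ m = e * e, n = f * f & r = e * f].
Proof.
(* Since r^2 = u v, gcd(u, r)^2 = gcd(u^2, u r, u v) = u gcd(u, r, v) = u. *)
have H u v : coprime u v -> u * v = r * r -> gcdn u r * gcdn u r = u.
  move=> cuv uv.
  rewrite muln_gcdl !muln_gcdr -uv (mulnC r u) gcdnA -(gcdnA (u * u)) gcdnn.
  rewrite -gcdnA -!muln_gcdr.
  by rewrite gcdnCA (eqP cuv) gcdn1 muln1.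
move=> cmn mn.
have Hm := H _ _ cmn mn.
have Hn : gcdn n r * gcdn n r = n by apply: (H n m); rewrite 1?coprime_sym // mulnC.
exists (gcdn m r), (gcdn n r); split=> //.
move: (mn); rewrite -{1}Hm -{1}Hn.
move: (gcdn m r) (gcdn n r) => e f ef; nia.
Qed.

Lemma coprime_mul_prime_sq p m n r : prime p -> coprime m n ->
  m * n = p * (r * r) ->
  (exists e f, [/\ m = p * (e * e), n = f * f & r = e * f]) \/
  (exists e f, [/\ m = e * e, n = p * (f * f) & r = e * f]).
Proof.
move=> pp cmn mn; have p0 := prime_gt0 pp.
have: p %| m * n by rewrite mn dvdn_mulr.
rewrite Euclid_dvdM // => /orP[] /dvdnP[k kE]; [left|right]; subst.
- have /coprime_mul_sq[] : k * n = r * r by nia.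
    by move: cmn; rewrite coprimeMl => /andP[].
  by move=> e [f [-> -> ->]]; exists e, f; split=> //; rewrite mulnC.
- have /coprime_mul_sq[] : m * k = r * r by nia.
    by move: cmn; rewrite coprimeMr => /andP[].
  by move=> e [f [-> -> ->]]; exists e, f; split=> //; rewrite mulnC.
Qed.

Lemma coprime_dvd2 m n m' n' : m' %| m -> n' %| n -> coprime m n -> coprime m' n'.
Proof. by move=> dm dn /(coprime_dvdl dm) /(coprime_dvdr dn). Qed.

(** Dividing by the gcd leaves coprime cofactors whose product is a square, so [c] can be the gcd
    itself. *)
Lemma sq_factor u v r : 0 < u -> u * v = r * r ->
  exists c e, [/\ c %| u, c %| v & u = c * (e * e)].
Proof.
move=> u0 uv; set g := gcdn u v.
have g0 : 0 < g by rewrite gcdn_gt0 u0.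
have [gu gv] : g %| u /\ g %| v by rewrite dvdn_gcdl dvdn_gcdr.
have [e [f [eE _ _]]] : exists e f, [/\ u %/ g = e * e, v %/ g = f * f & r %/ g = e * f].
  apply: coprime_mul_sq.
    by rewrite /coprime -(eqn_pmul2l g0) muln_gcdr !(mulnC g) !divnK // mul1n.
  have gr : g %| r.
    by rewrite -(@dvdn_pexp2r _ _ 2) // -!mulnn -uv dvdn_mul.
  move: uv; rewrite -{1}(divnK gu) -{1}(divnK gv) -{1 2}(divnK gr).
  move: (u %/ g) (v %/ g) (r %/ g) => a b c; nia.
by exists g, e; split=> //; rewrite -eE mulnC divnK.
Qed.

Lemma mulsq_sq c x r : 0 < c -> (c * c) * x = r * r ->
  exists d, x = d * d /\ r = c * d.
Proof.
move=> c0 cx.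
have /dvdnP[d dE] : c %| r.
  by rewrite -(@dvdn_pexp2r _ _ 2) // -!mulnn -cx dvdn_mulr.
exists d; split; last by rewrite mulnC.
have c20 : 0 < c * c by rewrite muln_gt0 c0.
by apply/eqP; rewrite -(eqn_pmul2l c20) cx dE; apply/eqP; lia.
Qed.

Lemma sq_mod3 n : (n * n) %% 3 = 0 /\ n %% 3 = 0 \/ (n * n) %% 3 = 1 /\ n %% 3 != 0.
Proof.
rewrite -modnMm; have: n %% 3 < 3 by rewrite ltn_mod.
by case: (n %% 3) => [|[|[|//]]]; auto.
Qed.

Lemma sq_mod5 n : [\/ (n * n) %% 5 = 0 /\ n %% 5 = 0, (n * n) %% 5 = 1 | (n * n) %% 5 = 4].
Proof.
rewrite -modnMm; have: n %% 5 < 5 by rewrite ltn_mod.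
by case: (n %% 5) => [|[|[|[|[|//]]]]] _;
  [apply: Or31|apply: Or32|apply: Or33|apply: Or33|apply: Or32].
Qed.

Lemma fourth_mod5 n : (n * n * (n * n)) %% 5 = 0 /\ n * n %% 5 = 0 \/
  (n * n * (n * n)) %% 5 = 1.
Proof.
rewrite -(modnMm (n * n) (n * n)) -(modnMm n n).
have: n %% 5 < 5 by rewrite ltn_mod.
by case: (n %% 5) => [|[|[|[|[|//]]]]]; auto.
Qed.

Lemma sq_mod7 n : [\/ (n * n) %% 7 = 0 /\ n %% 7 = 0,
  (n * n) %% 7 = 1, (n * n) %% 7 = 2 | (n * n) %% 7 = 4].
Proof.
rewrite -modnMm; have: n %% 7 < 7 by rewrite ltn_mod.
by case: (n %% 7) => [|[|[|[|[|[|[|//]]]]]]] _;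
  [apply: Or41|apply: Or42|apply: Or44|apply: Or43|apply: Or43|apply: Or44|apply: Or42].
Qed.

Lemma sq_mod8 n : [\/ odd n /\ (n * n) %% 8 = 1,
  n %% 4 = 2 /\ (n * n) %% 16 = 4 | n %% 4 = 0 /\ (n * n) %% 16 = 0].
Proof.
have -> : n %% 4 = n %% 16 %% 4 by rewrite modn_dvdm.
have -> : (n * n) %% 8 = (n * n) %% 16 %% 8 by rewrite modn_dvdm.
have -> : odd n = odd (n %% 16) by rewrite {1}(divn_eq n 16) oddD oddM andbF.
rewrite -modnMm; have: n %% 16 < 16 by rewrite ltn_mod.
move: (n %% 16) => m.
by case: m => [|[|[|[|[|[|[|[|[|[|[|[|[|[|[|[|//]]]]]]]]]]]]]]]] _;
  solve [apply: Or31; done | apply: Or32; done | apply: Or33; done].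
Qed.

Lemma odd_sq8 n : odd n -> exists t, n * n = 8 * t + 1.
Proof.
by case: (sq_mod8 n) => [[_ h]|[h _]|[h _]] on; [exists (n * n %/ 8); lia|lia|lia].
Qed.

Lemma no_between m k : m * m < k * k -> k * k < (m + 1) * (m + 1) -> False.
Proof. by move=> h1 h2; have [h|h] := leqP k m; nia. Qed.

(** With a = 2 k + 1 and b = 2 c the equation becomes k (k + 1) = 2 c^2. If k = 2 p^2, then a = 4
    p^2 + 1 lies strictly between consecutive squares; if k + 1 = 2 q^2, then a = 4 q^2 - 1 is 3
    modulo 4. *)
Lemma pell_not_sq a b : 0 < b -> a * a = 2 * (b * b) + 1 -> forall e, a <> e * e.
Proof.
move=> b0 ab e ae.
have oa : odd a by have := congr1 odd ab; rewrite oddM; lia.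
pose k := a./2; have aE : a = 2 * k + 1 by rewrite /k; lia.
have /dvdnP[c cE] : 2 %| b.
  have : odd b = false; last by lia.
  by have := congr1 odd ab; case: (sq_mod8 b) => [[? ?]|[? ?]|[? ?]]; nia.
have kk : k * k.+1 = 2 * (c * c) by nia.
have [[p [q [pE qE _]]]|[p [q [pE qE _]]]] :=
  coprime_mul_prime_sq (isT : prime 2) (coprimenS k) kk.
- have p0 : 0 < p by nia.
  by apply: (@no_between (2 * p) e); lia.
- have h : e * e + 1 = 4 * (q * q) by lia.
  by case: (sq_mod8 e) => [[? ?]|[? ?]|[? ?]]; lia.
Qed.

(* Division of two solutions of X ^ 2 - 2 Y ^ 2 = 1 would give one with 0 < Y < 2. *)
Lemma pell_gap M N L : 1 < N -> M * M = M + 2 * (N * N) -> N * N = N + 2 * (L * L) -> False.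
Proof.
case: N => [|[|n]] // _ h1 h2.
have [m mE] : exists m, M = m.+1 by exists M.-1; nia.
have e1 : (2 * m + 1) * (2 * m + 1) = 8 * (n.+2 * n.+2) + 1 by subst M; lia.
have e2 : (L * (2 * m + 1)) * (L * (2 * m + 1)) = L * L * (8 * (n.+2 * n.+2) + 1).
  by rewrite -e1; lia.
have e3 : 2 * (L * L) = n.+2 * n.+1 by lia.
have e4 : 2 * (L * L * (8 * (n.+2 * n.+2) + 1)) = n.+2 * n.+1 * (8 * (n.+2 * n.+2) + 1).
  by rewrite -e3; lia.
(* With N = n + 2, the square of [L * (2 * m + 1)] is N (N - 1) (8 N^2 + 1) / 2, strictly between
   the squares of 2 N^2 - N - 1 and 2 N^2 - N. *)
by apply: (@no_between (2 * (n * n) + 7 * n + 5) (L * (2 * m + 1))); rewrite e2; lia.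
Qed.

(** The factor 3 cannot belong to n + 1, since n would then be a square congruent to -1 modulo 3. So
    n = 3 p^2 and n + 1 = q^2, where p and q are coprime with product g^2 and hence squares
    themselves. *)
Lemma consec3_fourth g n : n * n.+1 = 3 * ((g * g) * (g * g)) ->
  exists r s, [/\ n.+1 = (r * r) * (r * r), n = 3 * ((s * s) * (s * s)) & g = r * s].
Proof.
move=> h.
have H x y : coprime x y -> x * y = g * g -> exists r s, [/\ x = r * r, y = s * s & g = r * s].
  by move=> c e; apply: coprime_mul_sq.
have [[p [q [pE qE gE]]]|[p [q [pE qE gE]]]] :=
  coprime_mul_prime_sq (isT : prime 3) (coprimenS n) h.
- have cpq : coprime p q.
    by apply: coprime_dvd2 (coprimenS n); rewrite ?qE ?pE ?mulnA dvdn_mull.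
  have [s [r [sE rE ->]]] := H p q cpq (esym gE).
  by exists r, s; split; [rewrite qE rE | rewrite pE sE | rewrite mulnC].
- have cpq : coprime p q.
    by apply: coprime_dvd2 (coprimenS n); rewrite ?qE ?pE ?mulnA dvdn_mull.
  have [r [s [sE _ _]]] := H p q cpq (esym gE).
  case: (sq_mod3 p) => [[h1 h2]|[h1 h2]]; lia.
Qed.

(* Fermat descent: n = 3 s^4, n + 1 = r^4 with g = r s; factoring r^4 - 1 and then
   p^4 - 1 = 12 q^4 leads to another solution, with q <= s / 2. *)
Lemma consec3_fourth_eq0 g n : n * n.+1 = 3 * ((g * g) * (g * g)) -> g = 0.
Proof.
elim/ltn_ind: g n => g IH n h; have [r [s [rE sE gE]]] := consec3_fourth h.
have [s0|s0] := posnP s; first by rewrite gE s0 muln0.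
have rs : (r * r) * (r * r) = 3 * ((s * s) * (s * s)) + 1 by lia.
have [or [k kE]] : odd r /\ exists k, s = 2 * k.
  have [||] := sq_mod8 r; have [||] := sq_mod8 s; have [||] := sq_mod8 (r * r);
    have [||] := sq_mod8 (s * s); move=> ? ? ? ?; try lia;
    by split; [lia | exists s./2; lia].
have [t tE] := odd_sq8 or.
have tk : t * (4 * t + 1) = 3 * ((k * k) * (k * k)).
  by move: rs; rewrite kE tE; lia.
have ct : coprime t (4 * t + 1) by rewrite /coprime gcdnMDl gcdn1.
have [[p [q [pE qE kpq]]]|[p [q [pE qE kpq]]]] :=
  coprime_mul_prime_sq (isT : prime 3) ct tk; last first.
  by case: (sq_mod3 r) => [[h1 h2]|[h1 h2]]; lia.
have cpq : coprime p q.
  by apply: coprime_dvd2 ct; rewrite ?qE ?pE ?mulnA dvdn_mull.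
have [u [v [uE vE kuv]]] := coprime_mul_sq cpq (esym kpq).
have ov : odd v by have := congr1 odd qE; rewrite vE !oddM; lia.
have [m mE] := odd_sq8 ov.
(* Here t = 3 u^4 and 4 t + 1 = v^4 with v^2 = 8 m + 1, so 4 m takes the role of n and u that of
   g. *)
have mu : (4 * m) * (4 * m).+1 = 3 * ((u * u) * (u * u)).
  by move: qE; rewrite vE mE pE uE; lia.
have u_lt : u < g by nia.
have u0 := IH u u_lt _ mu.
by move: s0; rewrite kE kuv u0.
Qed.

(** * Steps of a cycle *)

(* [x], [y], [z] are the tangent lengths of a Heronian triangle of perimeter [6 s]
   and area [6 r]. *)
Definition edge (s r : nat) : Prop := exists x y z,
  [/\ 0 < x, x <= y <= z, x + y + z = 3 * s & x * y * z * s = 12 * (r * r)].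

(* [Edgexy] is the equation of [edge s r] for the given values of the two smallest
   tangent lengths, [EdgeLarge] a consequence of [9 <= x y]. *)
Inductive edge_case (s r : nat) : Prop :=
| Edge12 of s * s = s + 2 * (r * r)
| Edge13 of 3 * (s * s) = 4 * s + 4 * (r * r)
| Edge15 of 5 * (s * s) = 10 * s + 4 * (r * r)
| Edge16 of 3 * (s * s) = 7 * s + 2 * (r * r)
| Edge23 of 3 * (s * s) = 5 * s + 2 * (r * r)
| Edge17 of 21 * (s * s) = 56 * s + 12 * (r * r)
| Edge18 of 2 * (s * s) = 6 * s + r * r
| Edge24 of 2 * (s * s) = 4 * s + r * r
| EdgeLarge of 9 * (s * s) <= 30 * s + 4 * (r * r).

(** The pairs with x y < 9 are (1, y) for y <= 8 and (2, y) for y <= 4. Of these, (1, 1), (1, 4) and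
    (2, 2) put (6 r)^2 or (3 r)^2 strictly between consecutive squares. For all other pairs x y z is
    at least 9 (3 s - 10), its value at (1, 9, 3 s - 10). *)
Lemma edge_caseP s r : 20 <= s -> edge s r -> edge_case s r.
Proof.
move=> s20 [x [y [z [x0 /andP[xy yz] sum prod]]]].
have L : 9 * (3 * s - 10) <= x * y * z -> edge_case s r.
  by move=> h; apply: EdgeLarge; have := leq_mul h (leqnn s); lia.
have [x3|x3] := leqP 3 x.
  apply: L; have h1 : 3 * (x + y) <= x * y + 9 by nia.
  have [w wE] : exists w, x + y = w + 6 by exists (x + y - 6); lia.
  have : (3 * w + 9) * z <= x * y * z by rewrite leq_mul2r; apply/orP; right; lia.
  have : 3 * w <= w * z by nia.
  by lia.
case: x x0 x3 xy sum prod L => [|[|[|x]]] // _ _ xy sum prod L.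
- have [y9|y9] := leqP 9 y.
    have [u [v [uE vE]]] : exists u v, y = u + 9 /\ z = v + 9.
      by exists (y - 9), (z - 9); lia.
    by apply: L; subst y z; nia.
  have zE : z = 3 * s - 1 - y by lia.
  case: y y9 xy yz sum prod L zE => [|[|[|[|[|[|[|[|[|y]]]]]]]]] // _ _ _ _ prod _ zE.
  + by case: (@no_between (3 * s - 2) (6 * r)); subst z; nia.
  + by apply: Edge12; subst z; nia.
  + by apply: Edge13; subst z; nia.
  + by case: (@no_between (3 * s - 3) (3 * r)); subst z; nia.
  + by apply: Edge15; subst z; nia.
  + by apply: Edge16; subst z; nia.
  + by apply: Edge17; subst z; nia.
  + by apply: Edge18; subst z; nia.
- have [y5|y5] := leqP 5 y.
    have [u [v [uE vE]]] : exists u v, y = u + 5 /\ z = v + 5.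
      by exists (y - 5), (z - 5); lia.
    by apply: L; subst y z; nia.
  have zE : z = 3 * s - 2 - y by lia.
  case: y y5 xy yz sum prod L zE => [|[|[|[|[|y]]]]] // _ _ _ _ prod _ zE.
  + by case: (@no_between (3 * s - 3) (3 * r)); subst z; nia.
  + by apply: Edge23; subst z; nia.
  + by apply: Edge24; subst z; nia.
Qed.

(** * Steps that follow the first Pell family *)

(** M - 1 and M are coprime with product 2 N^2, so one is a^2 and the other 2 b^2. *)
Lemma edge12_factor M N : 1 < M -> M * M = M + 2 * (N * N) ->
  exists a b, [/\ N = a * b, coprime a b, 0 < a, 0 < b &
    a * a + 1 = 2 * (b * b) \/ a * a = 2 * (b * b) + 1].
Proof.
case: M => [|[|n]] // _ h.
have h' : n.+1 * n.+2 = 2 * (N * N) by lia.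
have [[p [q [pE qE ->]]]|[p [q [pE qE ->]]]] :=
  coprime_mul_prime_sq (isT : prime 2) (coprimenS n.+1) h'.
- exists q, p; split; [exact: mulnC | | nia | nia | right; lia].
  by rewrite coprime_sym; apply: coprime_dvd2 (coprimenS n.+1); rewrite ?qE ?pE ?mulnA dvdn_mull.
- exists p, q; split; [by [] | | nia | nia | left; lia].
  by apply: coprime_dvd2 (coprimenS n.+1); rewrite ?qE ?pE ?mulnA dvdn_mull.
Qed.

(* The equation says that [K s (m s - j)] is a square, where [s = a b]. *)
Lemma square_class a b s m j K r : 0 < a -> coprime a b -> s = a * b ->
  j <= m * s -> K * (m * (s * s)) = K * (j * s) + r * r ->
  exists c e, [/\ c %| a, c %| K * j & a = c * (e * e)].
Proof.
move=> a0 cab sE jm h.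
have [q qE] : exists q, m * s = q + j by exists (m * s - j); lia.
have [||c [e [ca cv ae]]] := @sq_factor a (b * (q * K)) r => //.
  have : s * (m * s) = s * (q + j) by rewrite qE.
  by have -> : a * (b * (q * K)) = s * q * K by [rewrite sE; lia]; lia.
exists c, e; split=> //.
(* As c is prime to b, it divides K q; modulo c, which divides s, q = m s - j is -j. *)
have cb : coprime c b by apply: coprime_dvdl cab.
move: cv; rewrite Gauss_dvdr // => cq.
have : c %| (q + j) * K.
  by rewrite -qE sE mulnC !mulnA; apply: dvdn_mulr; rewrite dvdn_mull.
by rewrite mulnDl dvdn_addr // mulnC.
Qed.

(** 840 = 8 * 3 * 5 * 7 is the least common multiple of the values of [K * j] in the cases of
    [edge_case] where this is applied. The class c of a is odd and prime to 5 and 7, because a^2 = 2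
    b^2 + 1 makes -1/2 a non-residue obstruction there. So c is 1 or 3, and [pell_not_sq] excludes
    1. *)
Lemma square_class_even a b s m j K r : 0 < b -> coprime a b ->
  a * a = 2 * (b * b) + 1 -> s = a * b ->
  j <= m * s -> K * (m * (s * s)) = K * (j * s) + r * r -> K * j %| 840 ->
  (exists e, a = 3 * (e * e)) /\ 3 %| K * j.
Proof.
move=> b0 cab ab sE jm h d840.
have a0 : 0 < a by lia.
have [c [e [ca cK ae]]] := square_class a0 cab sE jm h.
have oa : odd a by have := congr1 odd ab; rewrite oddM; lia.
have c8 : coprime c 8 by rewrite (@coprime_pexpr 3 c 2) // coprimen2; apply: dvdn_odd ca oa.
have c5 : coprime c 5.
  apply: (coprime_dvdl ca); rewrite coprime_sym prime_coprime //.
  apply/negP => /dvdnP[k kE].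
  by move: ab; rewrite kE; case: (sq_mod5 b) => [[? _]|?|?]; lia.
have c7 : coprime c 7.
  apply: (coprime_dvdl ca); rewrite coprime_sym prime_coprime //.
  apply/negP => /dvdnP[k kE].
  by move: ab; rewrite kE; case: (sq_mod7 b) => [[? _]|?|?|?]; lia.
have c3 : c %| 3.
  have := dvdn_trans cK d840; rewrite -[840]/(8 * (5 * (7 * 3))).
  by rewrite !Gauss_dvdr.
have : c \in divisors 3 by rewrite -dvdn_divisors.
rewrite -[divisors 3]/[:: 1; 3] !inE => /orP[] /eqP cE; subst c.
  by case: (@pell_not_sq a b b0 ab e); rewrite ae mul1n.
by split=> //; exists e.
Qed.

Lemma square_class_odd a b s m j K r D : 0 < a -> coprime a b -> odd a ->
  s = a * b -> j <= m * s -> K * (m * (s * s)) = K * (j * s) + r * r ->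
  K * j %| 2 * D -> prime D ->
  exists e, a = e * e \/ a = D * (e * e).
Proof.
move=> a0 cab oa sE jm h d2 pD.
have [c [e [ca cK ae]]] := square_class a0 cab sE jm h.
have c2 : coprime c 2 by rewrite coprimen2; apply: dvdn_odd ca oa.
have := dvdn_trans cK d2; rewrite Gauss_dvdr // => /(prime_nt_dvdP pD) hD.
exists e; have [c1|c1] := eqVneq c 1; first by left; rewrite ae c1 mul1n.
by right; rewrite {1}ae hD.
Qed.

(** Since a, b and N are odd, parity rejects (x, y) = (1, 3), (1, 5), (1, 7), and residues modulo 8
    reject (2, 4). Neither a nor b is divisible by 3, which rejects (1, 8). Square classes handle
    (1, 6) and (2, 3): a and b are squares up to a factor 7 or 5, respectively. *)
Lemma edge_after_12_odd N N' a b : N = a * b -> coprime a b -> 0 < a -> 0 < b ->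
  20 <= N ->
  a * a + 1 = 2 * (b * b) -> edge_case N N' ->
  [\/ N * N = N + 2 * (N' * N') | 9 * (N * N) <= 30 * N + 4 * (N' * N')].
Proof.
move=> NE cab a0 b0 N20 ab.
have oa : odd a by have := congr1 odd ab; rewrite oddD oddM; lia.
have ob : odd b.
  by have [[? ?]|[? ?]|[? ?]] := sq_mod8 b; have [[? ?]|[? ?]|[? ?]] := sq_mod8 a; lia.
have oN : odd N by rewrite NE oddM oa.
have [t NN] := odd_sq8 oN.
have a5 : a %% 5 <> 0.
  move=> a5; have [k kE] : exists k, a = 5 * k by exists (a %/ 5); lia.
  by move: ab; rewrite kE; case: (sq_mod5 b) => [[? _]|?|?]; lia.
have a3 : a %% 3 <> 0.
  move=> a3; have [k kE] : exists k, a = 3 * k by exists (a %/ 3); lia.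
  by move: ab; rewrite kE; case: (sq_mod3 b) => [[? _]|[? _]]; lia.
have b3 : b %% 3 <> 0.
  move=> b3; have [k kE] : exists k, b = 3 * k by exists (b %/ 3); lia.
  by move: ab; rewrite kE; case: (sq_mod3 a) => [[? _]|[? _]]; lia.
have b7 : b %% 7 <> 0.
  move=> b7; have [k kE] : exists k, b = 7 * k by exists (b %/ 7); lia.
  by move: ab; rewrite kE; case: (sq_mod7 a) => [[? _]|?|?|?]; lia.
have cba : coprime b a by rewrite coprime_sym.
have Nba : N = b * a by rewrite mulnC.
have N8 e f : a = e * e -> b = f * f -> N %% 8 = 1.
  move=> aE bE; have : odd (e * f).
    by move: oa ob; rewrite aE bE !oddM !andbb => -> ->.
  by move=> /odd_sq8[k]; rewrite NE aE bE; lia.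
case; try by [move=> ?; exfalso; lia | auto].
- move=> h; exfalso.
  have h2 : 2 * (3 * (N * N)) = 2 * (7 * N) + (2 * N') * (2 * N') by lia.
  have j3 : 7 <= 3 * N by lia.
  have [e ae] := @square_class_odd a b N 3 7 2 _ 7 a0 cab oa NE j3 h2 (dvdnn _) isT.
  have [f bf] := @square_class_odd b a N 3 7 2 _ 7 b0 cba ob Nba j3 h2 (dvdnn _) isT.
  case: bf => bf; last lia.
  case: ae => ae.
    by have := N8 e f ae bf; case: (sq_mod8 N') => [[? ?]|[? ?]|[? ?]]; lia.
  (* With a = 7 e^2 and b = f^2 the relation is 49 e^4 + 1 = 2 f^4; fourth powers are 0 or 1 modulo
     5. *)
  have f5 : (f * f) %% 5 = 0.
    move: ab; rewrite ae bf.
    by case: (fourth_mod5 e); case: (fourth_mod5 f); lia.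
  have ef0 : 0 < 7 * (e * f) by rewrite !muln_gt0; lia.
  have ef2 : 0 < e * e * (f * f) by rewrite !muln_gt0; lia.
  (* For N = 7 X with X = (e f)^2, the equation makes 2 (3 X - 1) a square; it is 3 modulo 5 because
     5 divides X. *)
  have [|g [gE _]] := @mulsq_sq (7 * (e * f)) (2 * (3 * (e * e * (f * f)) - 1)) (2 * N') ef0.
    have [x xE] : exists x, e * e * (f * f) = x.+1 by exists (e * e * (f * f)).-1; lia.
    have NX : N = 7 * x.+1 by rewrite -xE NE ae bf; lia.
    have -> : 7 * (e * f) * (7 * (e * f)) = 49 * x.+1 by rewrite -xE; lia.
    by rewrite xE; move: h; rewrite NX; lia.
  have [y yE] : exists y, f * f = 5 * y by exists (f * f %/ 5); lia.
  have [z zE] : exists z, e * e * (f * f) = 5 * z by exists (e * e * y); rewrite yE; lia.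
  by case: (sq_mod5 g) => [[? ?]|?|?]; lia.
- move=> h; exfalso.
  have h2 : 2 * (3 * (N * N)) = 2 * (5 * N) + (2 * N') * (2 * N') by lia.
  have j3 : 5 <= 3 * N by lia.
  have [e ae] := @square_class_odd a b N 3 5 2 _ 5 a0 cab oa NE j3 h2 (dvdnn _) isT.
  have [f bf] := @square_class_odd b a N 3 5 2 _ 5 b0 cba ob Nba j3 h2 (dvdnn _) isT.
  case: ae => ae; last lia.
  case: bf => bf.
    by have := N8 e f ae bf; case: (sq_mod8 N') => [[? ?]|[? ?]|[? ?]]; lia.
  by move: ab; rewrite ae bf; case: (fourth_mod5 e); lia.
- move=> h; exfalso.
  have n3 : N %% 3 <> 0.
    by move/eqP; rewrite -/(dvdn 3 N) NE Euclid_dvdM // => /orP[] /eqP.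
  by case: (sq_mod3 N') => [[? _]|[? _]]; case: (sq_mod3 N) => [[? ?]|[? _]]; lia.
- by move=> h; exfalso; case: (sq_mod8 N') => [[? ?]|[? ?]|[? ?]]; lia.
Qed.

Lemma not_dvd3_of_pell u i m : i * i + 1 = 2 * (u * u) ->
  m * m = 4 * (u * u) * (i * i) -> m %% 3 <> 0.
Proof.
move=> hi hm m3.
have [u3 i3] : u * u %% 3 = 1 /\ i * i %% 3 = 1.
  by case: (sq_mod3 u) => [[? _]|[? _]]; case: (sq_mod3 i) => [[? _]|[? _]]; lia.
have [y yE] : exists y, i * i = 3 * y + 1 by exists (i * i %/ 3); lia.
have [w wE] : exists w, u * u = 3 * w + 1 by exists (u * u %/ 3); lia.
by move: hm; rewrite yE wE; case: (sq_mod3 m) => [[? _]|[? ?]]; lia.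
Qed.

(** [square_class_even] forces 3 to divide [K * j], which leaves only (x, y) = (1, 7), (1, 8) and
    the large case. *)
Lemma edge_after_12_even N N' a b : N = a * b -> coprime a b -> 0 < b ->
  20 <= N ->
  a * a = 2 * (b * b) + 1 -> edge_case N N' ->
  [\/ 2 * (N * N) = 6 * N + N' * N' /\ N' %% 3 = 0 /\ N' %% 9 <> 0 |
   9 * (N * N) <= 30 * N + 4 * (N' * N')].
Proof.
move=> NE cab b0 N20 ab.
have oa : odd a by have := congr1 odd ab; rewrite oddM; lia.
have C m j K r : j <= m * N -> K * (m * (N * N)) = K * (j * N) + r * r ->
  K * j %| 840 -> (exists e, a = 3 * (e * e)) /\ 3 %| K * j.
  exact: (square_class_even b0 cab ab NE).
have b4 e : a = 3 * (e * e) -> b %% 4 = 2.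
  move=> aE; have [k kE] : exists k, e * e = 8 * k + 1.
    by apply: odd_sq8; move: oa; rewrite aE !oddM => /andP[_ /andP[]].
  by move: ab; rewrite aE kE; case: (sq_mod8 b) => [[? ?]|[? ?]|[? ?]]; lia.
case; try by [auto].
- by move=> h; case: (@C 1 1 2 (2 * N')) => //; lia.
- by move=> h; case: (@C 3 4 1 (2 * N')) => //; lia.
- by move=> h; case: (@C 5 10 1 (2 * N')) => //; lia.
- by move=> h; case: (@C 3 7 2 (2 * N')) => //; lia.
- by move=> h; case: (@C 3 5 2 (2 * N')) => //; lia.
- move=> h; exfalso.
  case: (@C 3 8 21 (6 * N')) => // [||[e ae] _]; [lia | lia |].
  (* N is twice an odd number n, and the equation divided by 4, 21 n^2 = 28 n + 3 N'^2, fails modulo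
     8. *)
  have b2 := b4 e ae.
  have [c cE] : exists c, b = 2 * c by exists (b %/ 2); lia.
  have [k kE] : exists k, a * c * (a * c) = 8 * k + 1.
    by apply: odd_sq8; rewrite oddM oa; lia.
  have oac : odd (a * c) by rewrite oddM oa; lia.
  have Nac : N = 2 * (a * c) by rewrite NE cE; lia.
  move: h; rewrite Nac; clear -kE oac; move: (a * c) kE oac => n.
  by case: (sq_mod8 N') => [[? ?]|[? ?]|[? ?]]; lia.
(* Here a = 3 e^2 and b = 2 f^2, so N = 6 X with X = (e f)^2. Then N' = 3 m with m^2 = 4 X (2 X -
   1), so 2 X - 1 is a square i^2, and modulo 3 this keeps m away from 0. *)
- move=> h; left.
  case: (@C 1 3 2 N') => // [||[e ae] _]; [lia | lia |].
  have b2 := b4 e ae.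
  have cba : coprime b a by rewrite coprime_sym.
  have [|||c [f [cb c6 bE]]] := @square_class b a N 1 3 2 N' b0 cba;
    [by rewrite mulnC | lia | lia |].
  have c3 : coprime c 3.
    by apply: (coprime_dvd2 cb _ cba); rewrite ae dvdn_mulr.
  have : c %| 2 by move: c6; rewrite Gauss_dvdl.
  move=> /(prime_nt_dvdP (isT : prime 2)) c2.
  have {}c2 : c = 2.
    apply: c2; apply/eqP => c1; move: bE b2; rewrite c1 mul1n => ->.
    by case: (sq_mod8 f) => [[? ?]|[? ?]|[? ?]]; lia.
  pose X := e * f * (e * f); have X0 : 0 < X by rewrite !muln_gt0; lia.
  have NX : N = 6 * X by rewrite NE ae bE c2 /X; lia.
  have [x xE] : exists x, X = x.+1 by exists X.-1; lia.
  have [|m [mE N'E]] := @mulsq_sq 3 (4 * X * (2 * X - 1)) N' isT.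
    by move: h; rewrite NX xE; lia.
  have ef0 : 0 < 2 * (e * f) by rewrite muln_gt0; move: X0; rewrite /X muln_gt0 => /andP[].
  have [|i [iE mE2]] := @mulsq_sq (2 * (e * f)) (2 * X - 1) m ef0.
    by rewrite -mE; have -> : 2 * (e * f) * (2 * (e * f)) = 4 * X by rewrite /X; lia.
  suff m3 : m %% 3 <> 0.
    by clear -h N'E m3; split=> //; split; lia.
  apply: (@not_dvd3_of_pell (e * f) i m); last by rewrite -mE iE.
  by rewrite -iE -/X; clear -X0; lia.
- by move=> h; case: (@C 2 4 1 N') => //; lia.
Qed.

Lemma edge_after_12 M N N' : 60 < M -> M * M = M + 2 * (N * N) ->
  edge_case N N' -> N' <= M ->
  [/\ 2 * (N * N) = 6 * N + N' * N', N' %% 3 = 0 & N' %% 9 <> 0].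
Proof.
move=> M60 MN NN' N'M.
have N20 : 20 <= N by rewrite leqNgt; apply/negP => h; nia.
have NM : N < M by rewrite ltnNge; apply/negP => h; nia.
have N43 : 4 * N <= 3 * M by rewrite leqNgt; apply/negP => h; nia.
(* With 2 N^2 = M^2 - M, 4 N <= 3 M and N' <= M, the inequality would give M <= 54. *)
have large : 9 * (N * N) <= 30 * N + 4 * (N' * N') -> False.
  move=> h; have h1 : N' * N' <= M * M by rewrite leq_mul.
  have h2 : 61 * M <= M * M by rewrite leq_mul2r M60 orbT.
  by lia.
have [|a [b [NE cab a0 b0 ab]]] := edge12_factor _ MN; first by lia.
case: ab => ab.
- have [h|/large//] := edge_after_12_odd NE cab a0 b0 N20 ab NN'.
  by case: (@pell_gap M N N'); lia.
- by have [[h [h3 h9]]|/large//] := edge_after_12_even NE cab b0 N20 ab NN'.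
Qed.

(** * The second Pell family and descents above 60 *)

(** Put P = c^2 = 8 p + 1 and d^2 = P + 8 t. The equations give b^2 = 8 t (8 p + 2 t + 1), whose
    coprime parts yield 2 t = g^2. Completing the square gives (P - 2 g^2)^2 = 12 g^4 + 1, that is,
    x (x + 1) = 3 g^4, so g = 0 by descent and b = 0. *)
Lemma quartic_pair c d b : odd c -> odd d -> coprime c d -> 0 < b ->
  d * d * (d * d) + 2 = 3 * (c * c * (c * c)) ->
  c * c * (d * d) = 2 * (b * b) + 1 -> False.
Proof.
move=> oc od cd b0.
have [p pE] := odd_sq8 oc; have [q qE] := odd_sq8 od.
have : coprime (c * c) (d * d) by rewrite !coprimeMl !coprimeMr cd.
rewrite pE qE => cPQ h1 h2.
have pq : p <= q.
  rewrite leqNgt; apply/negP => h; have [k kE] : exists k, p = q + k + 1 by exists (p - q - 1); lia.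
  by move: h1; rewrite kE; lia.
have [t tE] : exists t, q = p + t by exists (q - p); lia.
subst q; clear pq qE pE oc od cd.
have bt : 8 * (8 * p + 2 * t + 1) * t = b * b by lia.
have [k kE] : exists k, b = 2 * k.
  by case: (sq_mod8 b) => [[? ?]|[? ?]|[? ?]]; first lia; exists (b %/ 2); lia.
have kt : (8 * p + 2 * t + 1) * (2 * t) = k * k by move: bt; rewrite kE; lia.
have ct : coprime (8 * p + 2 * t + 1) (2 * t).
  have -> : 8 * p + 2 * t + 1 = 1 * (2 * t) + (8 * p + 1) by lia.
  rewrite coprime_sym /coprime gcdnMDl -/(coprime _ _) coprime_sym.
  apply: (@coprime_dvd2 _ (8 * t) _ _ (dvdnn _)); first by rewrite -[8]/(4 * 2) -mulnA dvdn_mull.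
  rewrite /coprime -(gcdnMDl 1) mul1n -/(coprime _ _).
  by have <- : 8 * (p + t) + 1 = 8 * p + 1 + 8 * t by lia.
have [e [g [_ gE _]]] := coprime_mul_sq ct kt.
have h3 : (8 * p + 1) * (8 * p + 1) = 4 * (8 * p + 1) * (g * g) + 8 * (g * g * (g * g)) + 1.
  by rewrite -gE; move: h1; lia.
have pg : 2 * (g * g) < 8 * p + 1 by rewrite ltnNge; apply/negP => h; nia.
have [og xE] : exists x, 8 * p + 1 = 2 * (g * g) + 2 * x + 1.
  by exists ((8 * p - 2 * (g * g)) %/ 2); lia.
have : og * og.+1 = 3 * (g * g * (g * g)) by move: h3; rewrite xE; lia.
move=> /consec3_fourth_eq0 g0; subst g.
have t0 : t = 0 by lia.
by move: bt; rewrite t0 muln0; case: (b) b0.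
Qed.

(** With M = 2 m, m (3 m - 2) = N^2 leads to m = e^2, 3 e^2 = f^2 + 2 and N = e f with e, f odd and
    coprime. Parity and size then leave only (x, y) = (1, 2) for the next step, which makes e and f
    squares and N = 2 b^2 + 1: the situation of [quartic_pair]. *)
Lemma edge_after_13 M N N' : 60 < M -> 3 * (M * M) = 4 * M + 4 * (N * N) ->
  edge_case N N' -> N' <= M -> False.
Proof.
move=> M60 MN NN' N'M.
have N20 : 20 <= N by rewrite leqNgt; apply/negP => h; nia.
have NM : N < M by rewrite ltnNge; apply/negP => h; nia.
have [m mE] : exists m, M = 2 * m.
  by exists (M %/ 2); case: (sq_mod8 M) => [[? ?]|[? ?]|[? ?]]; lia.
have mN : m * (3 * m - 2) = N * N by move: MN; rewrite mE; nia.
have [c [e [cm cm2 me]]] := @sq_factor m (3 * m - 2) N ltac:(lia) mN.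
have c2 : c %| 2.
  rewrite -(dvdn_addr _ cm2); have -> : 3 * m - 2 + 2 = 3 * m by lia.
  by rewrite dvdn_mull.
have [f [fE Nf]] : exists f, 3 * (e * e) = f * f + 2 /\ N = e * f.
  have [c1|c1] := eqVneq c 1.
    have e0 : 0 < e by move: me; rewrite c1; case: (e) => //; lia.
    have [|f [fE NE]] := @mulsq_sq e (3 * (e * e) - 2) N e0.
      by rewrite -mN me c1 !mul1n.
    exists f; split=> //; have : 0 < e * e by rewrite muln_gt0 e0.
    by clear -fE; lia.
  (* For m = 2 e^2 the cofactor 3 e^2 - 1 would be a square congruent to -1 modulo 3. *)
  exfalso; have {}c2 := prime_nt_dvdP (isT : prime 2) c1 c2.
  have e0 : 0 < 2 * e by move: me; rewrite c2; case: (e) => //; lia.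
  have [|f [fE NE]] := @mulsq_sq (2 * e) (3 * (e * e) - 1) N e0.
    have -> : 2 * e * (2 * e) = 4 * (e * e) by lia.
    by rewrite -mN me c2; clear; case: (e * e) => [|x]; lia.
  have ee0 : 0 < e * e by rewrite muln_gt0; case: (e) e0.
  by clear -fE ee0; case: (sq_mod3 f) => [[? _]|[? _]]; lia.
have [oe odf] : odd e /\ odd f.
  clear -fE.
  by case: (sq_mod8 e) => [[? ?]|[? ?]|[? ?]]; case: (sq_mod8 f) => [[? ?]|[? ?]|[? ?]]; lia.
have cef : coprime e f.
  rewrite /coprime; have : coprime (gcdn e f) 2.
    by rewrite coprimen2; apply: dvdn_odd (dvdn_gcdl e f) oe.
  suff g2 : gcdn e f %| 2 by rewrite /coprime (gcdn_idPl g2).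
  have <- : 3 * (e * e) - f * f = 2 by rewrite fE addKn.
  by apply: dvdn_sub; [rewrite dvdn_mull // dvdn_mulr // dvdn_gcdl |
    rewrite dvdn_mulr // dvdn_gcdr].
have oN : odd N by rewrite Nf oddM oe.
have [t NN] := odd_sq8 oN.
have h1 : N' * N' <= M * M by rewrite leq_mul.
have h2 : 61 * M <= M * M by rewrite leq_mul2r M60 orbT.
have h : N * N = N + 2 * (N' * N').
  by clear -MN NN h1 h2 M60 NM NN'; case: NN' => h; lia.
have e0 : 0 < e by case: (e) oe.
have f0 : 0 < f by case: (f) odf.
have h4 : 2 * (1 * (N * N)) = 2 * (1 * N) + (2 * N') * (2 * N') by clear -h; lia.
have j3 : 1 <= 1 * N by lia.
have sq u v : 0 < u -> coprime u v -> odd u -> N = u * v -> exists c, u = c * c.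
  move=> u0 cuv ou Nuv.
  have [c1 [x [c1u c12 uE]]] := square_class u0 cuv Nuv j3 h4.
  exists x; suff c11 : c1 = 1 by rewrite uE c11 mul1n.
  apply/eqP; rewrite -dvdn1 -(@Gauss_dvdr _ 2) ?muln1 //.
  by rewrite coprimen2; apply: dvdn_odd c1u ou.
have [c1 eE] := sq e f e0 cef oe Nf.
have [d fE2] : exists c, f = c * c by apply: (sq f e); rewrite // 1?coprime_sym // mulnC.
have [x xE] : exists x, N = x + 1 by exists N.-1; rewrite addn1 prednK // (leq_trans _ N20).
have [||y [yE _]] := @mulsq_sq (c1 * d) (2 * x) (2 * N').
- by move: e0 f0; rewrite eE fE2 !muln_gt0 => /andP[-> _] /andP[-> _].
- have -> : c1 * d * (c1 * d) = N by rewrite Nf eE fE2; clear; lia.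
  by move: h; rewrite xE; clear; lia.
have [b bE] : exists b, y = 2 * b.
  by exists (y %/ 2); clear -yE; case: (sq_mod8 y) => [[? ?]|[? ?]|[? ?]]; lia.
have oc : odd c1 by move: oe; rewrite eE oddM andbb.
have od : odd d by move: odf; rewrite fE2 oddM andbb.
apply: (@quartic_pair c1 d b oc od).
- by move: cef; rewrite eE fE2 !coprimeMl !coprimeMr => /andP[/andP[]].
- by move: yE; rewrite bE; case: (b) => //; clear -xE N20; lia.
- by move: fE; rewrite eE fE2; clear; lia.
- by rewrite -eE -fE2 -Nf xE; move: yE; rewrite bE; clear; lia.
Qed.

(* No descending edge starts above 60, apart from the two Pell families, and these
   cannot be continued without exceeding their starting point. *)
Lemma no_large_descent M N N' N'' : 60 < M -> N < M -> N' <= M -> N'' <= M ->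
  edge M N -> edge N N' -> edge N' N'' -> False.
Proof.
move=> M60 NM N'M N''M MN NN' N'N''.
have h2 : 61 * M <= M * M by rewrite leq_mul2r M60 orbT.
have h3 : N * N <= M * M by rewrite leq_mul // ltnW.
have h0 : edge_case M N by apply: edge_caseP => //; lia.
case: h0 => MN'; try lia; last first.
  have N20 : 20 <= N by rewrite leqNgt; apply/negP => h; nia.
  by apply: (edge_after_13 M60 MN' (edge_caseP N20 NN')).
have N20 : 20 <= N by rewrite leqNgt; apply/negP => h; nia.
have [h N'3 N'9] := edge_after_12 M60 MN' (edge_caseP N20 NN') N'M.
have N'20 : 20 <= N' by rewrite leqNgt; apply/negP => h'; nia.
have h1 : N'' * N'' <= M * M by rewrite leq_mul.
have [m mE] : exists m, N' = 3 * m by exists (N' %/ 3); lia.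
(* By size only [Edge12] and [Edge13] survive; in both, 3 divides N'' and then 9 divides N'. *)
case: (edge_caseP N'20 N'N'') => h'; try lia.
- case: (sq_mod3 N'') => [[? h4]|[? ?]]; last by subst; lia.
  by have [k kE] : exists k, N'' = 3 * k; [exists (N'' %/ 3); lia | subst; lia].
- case: (sq_mod3 N'') => [[? h4]|[? ?]]; last by subst; lia.
  by have [k kE] : exists k, N'' = 3 * k; [exists (N'' %/ 3); lia | subst; lia].
Qed.

(** * Steps up to 60 and the values in a cycle *)

(* Records the descending edges from [s <= 60], and what may follow them. *)
Definition small_edge (s r : nat) : bool :=
  match s with
  | 1 => false
  | 2 => r == 1
  | 3 => (r == 2) || (3 <= r)
  | 6 => (r \in [:: 6; 8]) || (9 <= r)
  | 8 => 9 < r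
  | 9 => (r == 6) || (9 < r)
  | 15 => 18 < r
  | 18 => (r == 15) || (18 <= r)
  | 35 => 50 < r
  | 50 => (r == 35) || (50 <= r)
  | _ => s <= r
  end.

(** Binary numbers keep the computation fast; the integer square root of q / 12 is the only
    candidate for the target of the step. *)
Definition check_edge (s x y : nat) : bool :=
  let: (s', x', y') := (N.of_nat s, N.of_nat x, N.of_nat y) in
  let z := (3 * s' - x' - y')%num in
  let q := (x' * y' * z * s')%num in
  let r := N.sqrt (q / 12) in
  (N.eqb (12 * (r * r)) q && N.leb y' z)%num ==> small_edge s (N.to_nat r).

Lemma check_edges : all (fun s => all (fun x => all (check_edge s x)
  (iota 1 24)) (iota 1 4)) (iota 1 60).
Proof. by vm_compute. Qed.

(** The ratio 10/7 fits the entry 35 of the table, which excludes r = 50. *)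
Lemma small_ascent s r : 2 < s <= 60 -> 10 * s < 7 * r -> small_edge s r.
Proof.
case: s => [|[|[|s]]] //= _.
by do 48![case: s => [|s] /=; first by rewrite ?inE; lia]; lia.
Qed.

(** If 7 r <= 10 s, then 12 r^2 < 25 s^2, and z >= s gives x y < 25. This is the finite range
    covered by [check_edges]; steeper ascents are left to [small_ascent]. *)
Lemma edge_small s r : 0 < s <= 60 -> edge s r -> small_edge s r.
Proof.
move=> s60 [x [y [z [x0 /andP[xy yz] sum prod]]]].
have [/andP[s2 sr]|sr] := boolP ((2 < s) && (10 * s < 7 * r)).
  by apply: small_ascent => //; lia.
have xy25 : x * y < 25.
  have [s2|s2] := leqP s 2; first by nia.
  have r2 : 12 * (r * r) < 25 * (s * s) by nia.
  have z0 : 0 < s * s by nia.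
  rewrite ltnNge; apply/negP => h.
  have sz : s <= z by lia.
  have : 25 * (s * s) <= x * y * z * s.
    by rewrite mulnA leq_mul2r; apply/orP; right; rewrite leq_mul.
  by lia.
have [x4 y24] : x <= 4 /\ y <= 24 by split; nia.
have /allP/(_ s) := check_edges; rewrite mem_iota => /(_ ltac:(lia)).
move=> /allP/(_ x); rewrite mem_iota => /(_ ltac:(lia)).
move=> /allP/(_ y); rewrite mem_iota => /(_ ltac:(lia)).
rewrite /check_edge.
have -> : (3 * N.of_nat s - N.of_nat x - N.of_nat y = N.of_nat z)%num by lia.
have -> : (N.of_nat x * N.of_nat y * N.of_nat z * N.of_nat s
  = (N.of_nat r * N.of_nat r) * 12)%num by lia.
rewrite N.div_mul // N.sqrt_square Nnat.Nat2N.id N.mul_comm N.eqb_refl.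
by have -> : N.leb (N.of_nat y) (N.of_nat z) by lia.
Qed.

Lemma ordS_trans n (P : 'I_n -> Prop) (i : 'I_n) : P i ->
  (forall k, P k -> P (ordS k)) -> forall j, P j.
Proof.
move=> Pi PS j.
have H k : P (iter k (@ordS n) i) by elim: k => //= k; apply: PS.
have V k : iter k (@ordS n) i = (i + k) %% n :> nat.
  elim: k => [|k IH] /=; first by rewrite addn0 modn_small.
  by rewrite IH -addn1 modnDml addn1 addnS.
suff -> : j = iter (n - i + j) (@ordS n) i by [].
apply: val_inj; rewrite /= V addnA subnKC; last exact: ltnW.
by rewrite modnDl modn_small.
Qed.

Lemma small_descent M N : M <= 60 -> N < M -> small_edge M N ->
  (M, N) \in [:: (2, 1); (3, 2); (9, 6); (18, 15); (50, 35)].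
Proof.
move=> _; do 51![case: M => [|M] /=; first by rewrite ?inE ?xpair_eqE /=; lia].
by lia.
Qed.

Lemma edge_cycle n (f : 'I_n -> nat) :
  (forall i, edge (f i) (f (ordS i))) -> (exists i, f i <> f (ordS i)) ->
  forall i, f i = 6 \/ f i = 9.
Proof.
move=> E [i0 ne].
have [m mmax] : exists m, forall i, f i <= f m.
  by exists [arg max_(i > i0) f i]; case: arg_maxnP => // m _ mm i; apply: mm.
(* If every maximal value were followed by a maximal value, [f] would be constant. *)
have [i [iM iD]] : exists i, f i = f m /\ f (ordS i) < f m.
  have [/existsP[i /andP[/eqP ? ?]]|] := boolP [exists i, (f i == f m) && (f (ordS i) < f m)].
    by exists i.
  rewrite negb_exists => /forallP c; exfalso; apply: ne.
  have /(_ _) all_m : forall k, f k = f m.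
    apply: (ordS_trans (i := m)) => // k kM; apply/eqP.
    by have := c k; rewrite kM eqxx /= -leqNgt eqn_leq mmax.
  by rewrite !all_m.
have M60 : f m <= 60.
  rewrite leqNgt; apply/negP => M60.
  apply: (no_large_descent M60 iD (mmax (ordS (ordS i))) (mmax (ordS (ordS (ordS i))))) => //.
  by rewrite -iM.
have f0 k : 0 < f k by have [x [y [z [? ? ? ?]]]] := E k; lia.
have S k : small_edge (f k) (f (ordS k)).
  by apply: edge_small => //; rewrite f0 (leq_trans (mmax k)).
have [M9 N6] : f m = 9 /\ f (ordS i) = 6.
  have := S i; have := S (ordS i); have := S (ordS (ordS i)).
  have := mmax (ordS (ordS i)); have := mmax (ordS (ordS (ordS i))).
  rewrite iM => h1 h2 h3 h4 h5.
  have := small_descent M60 iD h5; rewrite !inE !xpair_eqE.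
  (* The descents 2 -> 1 and 3 -> 2 -> 1 end at 1, which no step leaves; 18 -> 15 and 50 -> 35 can
     only be followed by a value above the maximum. *)
  move=> /or4P[||| /orP[]] /andP[/eqP Me /eqP Ne].
  - by move: h4; rewrite Ne.
  - by move: h4 h3; rewrite Ne /= => /eqP ->.
  - by [].
  - by move: h4 h2; rewrite Ne Me /=; lia.
  - by move: h4 h2; rewrite Ne Me /=; lia.
apply: (ordS_trans (i := i)) => [|k]; first by right; rewrite iM.
have := S k; have := S (ordS k); have := mmax (ordS k); have := mmax (ordS (ordS k)).
rewrite M9; move: (f k) (f (ordS k)) (f (ordS (ordS k))) => a b c cM bM.
(* Below the maximum 9, the value 6 could also be followed by 8, but every step from 8 exceeds 9. *)
by move=> h1 h2 [a6|a9]; subst a; move: h2; rewrite /= ?inE; [move=> /orP[/orP[]|] | move=> /orP[]];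
 try lia; move=> /eqP b8; subst b; move: h1 => /=; lia.
Qed.

Lemma edge_triangle s r x y z : s \in [:: 6; 9] -> r \in [:: 6; 9] ->
  0 < x -> x <= y <= z -> x + y + z = 3 * s -> x * y * z * s = 12 * (r * r) ->
  (s, r, x, y, z) \in [:: (6, 6, 1, 8, 9); (6, 9, 3, 6, 9); (9, 6, 1, 2, 24)].
Proof.
move=> s69 r69 x0 xyz sum prod.
have C : all (fun s => all (fun r => all (fun x => all (fun y =>
   let z := 3 * s - x - y in
   (x <= y <= z) && (x * y * z * s == 12 * (r * r)) ==>
   ((s, r, x, y, z) \in [:: (6, 6, 1, 8, 9); (6, 9, 3, 6, 9); (9, 6, 1, 2, 24)]))
   (iota 1 27)) (iota 1 9)) [:: 6; 9]) [:: 6; 9] by vm_cast_no_check (erefl true).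
have zE : z = 3 * s - x - y by lia.
have s9 : s <= 9 by move: s69; rewrite !inE => /orP[] /eqP ->.
move/allP/(_ s s69)/allP/(_ r r69)/allP/(_ x): C; rewrite mem_iota => /(_ ltac:(lia)).
move=> /allP/(_ y); rewrite mem_iota => /(_ ltac:(lia)) /=.
by rewrite -zE xyz prod eqxx.
Qed.

(** * Triangles *)

Import Order.TTheory GRing.Theory Num.Theory.
Local Open Scope ring_scope.


Lemma dist_sqr (R : realType) (P Q : R * R) : dist P Q ^+ 2 = (P.1 - Q.1) ^+ 2 + (P.2 - Q.2) ^+ 2.
Proof. by rewrite sqr_sqrtr // addr_ge0 ?sqr_ge0. Qed.

Lemma dist_nat (R : realType) (P Q : R * R) (d : nat) :
  (P.1 - Q.1) ^+ 2 + (P.2 - Q.2) ^+ 2 = d%:R ^+ 2 -> dist P Q = d%:R.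
Proof. by rewrite /dist => ->; rewrite sqrtr_sqr normr_nat. Qed.

Lemma distC (R : realType) (P Q : R * R) : dist P Q = dist Q P.
Proof. by rewrite /dist -(sqrrN (P.1 - _)) -(sqrrN (P.2 - _)) !opprB. Qed.

Lemma perimeterE (R : realType) (T : triangle R) : perimeter T = dist (vertB T) (vertC T) +
  dist (vertC T) (vertA T) + dist (vertA T) (vertB T).
Proof. by rewrite /perimeter !big_cons big_nil addr0 addrA. Qed.

Lemma heron_formula (R : realType) (T : triangle R) (a := dist (vertB T) (vertC T))
    (b := dist (vertC T) (vertA T)) (c := dist (vertA T) (vertB T)) :
  16 * area T ^+ 2 = (a + b + c) * (b + c - a) * (a + c - b) * (a + b - c).
Proof.
have -> : (a + b + c) * (b + c - a) * (a + c - b) * (a + b - c) =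
  2 * (a ^+ 2 * b ^+ 2 + b ^+ 2 * c ^+ 2 + c ^+ 2 * a ^+ 2)
  - (a ^+ 2) ^+ 2 - (b ^+ 2) ^+ 2 - (c ^+ 2) ^+ 2 by ring.
rewrite !dist_sqr /area expr_div_n real_normK ?num_real //.
by field.
Qed.

(** The three factors have pairwise sums 2 a, 2 b, 2 c. If one were at most 0, the other two would
    be nonnegative and the product could not be positive. *)
Lemma tangent_lengths_gt0 (a b c : int) : 0 <= a -> 0 <= b -> 0 <= c ->
  0 < (a + b + c) * (b + c - a) * (a + c - b) * (a + b - c) ->
  [/\ 0 < b + c - a, 0 < a + c - b & 0 < a + b - c].
Proof.
have key (u v w : int) : 0 <= u + v -> 0 <= u + w -> 0 <= v + w ->
    0 < (u + v + w) * (u * (v * w)) -> 0 < u.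
  move=> uv uw vw p; rewrite ltNge; apply/negP => u0; move: p.
  apply/negP; rewrite -leNgt mulr_ge0_le0 //; first by lia.
  by rewrite mulr_le0_ge0 // mulr_ge0; lia.
move=> a0 b0 c0 p; split.
- by apply: (key _ (a + c - b) (a + b - c)); try lia; move: p; congr (0 < _); ring.
- by apply: (key _ (b + c - a) (a + b - c)); try lia; move: p; congr (0 < _); ring.
- by apply: (key _ (b + c - a) (a + c - b)); try lia; move: p; congr (0 < _); ring.
Qed.

(* [x], [y], [z] are the distances from the vertices to the points of tangency
   of the incircle. *)
Lemma heronian_nat (R : realType) (T : triangle R) : heronian T -> exists x y z m : nat,
  [/\ side_lengths T = [:: (y + z)%:R; (x + z)%:R; (x + y)%:R],
      area T = m%:R, (0 < x)%N && (0 < y)%N && (0 < z)%N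
    & (m * m = x * y * z * (x + y + z))%N].
Proof.
case=> nd sides_int area_int.
have nat_of (r : R) : 0 <= r -> r \is a Num.int -> exists k : nat, r = k%:R.
  by move=> r0 ri; apply/natrP; rewrite natrEint ri.
have d0 (P Q : R * R) : 0 <= dist P Q by apply: sqrtr_ge0.
have [m mE] : exists m : nat, area T = m%:R.
  by apply: nat_of => //; rewrite /area divr_ge0.
have [a aE] := nat_of _ (d0 _ _) (sides_int (dist (vertB T) (vertC T))
  ltac:(by rewrite !inE eqxx ?orbT)).
have [b bE] := nat_of _ (d0 _ _) (sides_int (dist (vertC T) (vertA T))
  ltac:(by rewrite !inE eqxx ?orbT)).
have [c cE] := nat_of _ (d0 _ _) (sides_int (dist (vertA T) (vertB T))
  ltac:(by rewrite !inE eqxx ?orbT)).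
have := heron_formula T; rewrite aE bE cE mE => H.
have {}H : 16 * (m%:Z * m%:Z) =
    (a%:Z + b%:Z + c%:Z) * (b%:Z + c%:Z - a%:Z) * (a%:Z + c%:Z - b%:Z) * (a%:Z + b%:Z - c%:Z).
  by apply: (@intr_inj R); rewrite !(rmorphM, rmorphD, rmorphN) /= -?pmulrn -expr2.
have m0 : 0 < m%:Z by rewrite ltz_nat lt0n -(@pnatr_eq0 R) -mE.
have [||||u0 v0 w0] := @tangent_lengths_gt0 a%:Z b%:Z c%:Z => //.
  by rewrite -H !pmulr_rgt0.
have [x xE] : exists x : nat, (b + c = a + 2 * x)%N.
  exists ((b + c - a) %/ 2)%N.
  suff : ~~ odd (a + b + c) by lia.
  (* An odd perimeter would make all four factors in Heron's formula odd, yet their product is 16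
     m^2. *)
  apply/negP => o; have [k kE] : exists k : int, a%:Z + b%:Z + c%:Z = 2 * k + 1.
    by exists ((a + b + c) %/ 2)%N; lia.
  have [k1 k2 k3] : [/\ b%:Z + c%:Z - a%:Z = 2 * (k - a%:Z) + 1,
    a%:Z + c%:Z - b%:Z = 2 * (k - b%:Z) + 1 &
    a%:Z + b%:Z - c%:Z = 2 * (k - c%:Z) + 1] by split; lia.
  by move: H; rewrite k1 k2 k3 kE; clear; lia.
have [y yE] : exists y : nat, (a + c = b + 2 * y)%N by exists ((a + c - b) %/ 2)%N; lia.
have [z zE] : exists z : nat, (a + b = c + 2 * z)%N by exists ((a + b - c) %/ 2)%N; lia.
have [aE' bE' cE'] : [/\ a = y + z, b = x + z & c = x + y]%N by split; lia.
exists x, y, z, m; split=> //; first by rewrite /side_lengths aE bE cE aE' bE' cE'.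
  by lia.
by move: H; rewrite aE' bE' cE'; clear; nia.
Qed.

Lemma congruent_vertices (R : realType) (A B C A' B' C' : R * R) :
  area (Triangle A B C) != 0 ->
  dist A B = dist A' B' -> dist B C = dist B' C' -> dist C A = dist C' A' ->
  exists f : R * R -> R * R, (forall P Q, dist (f P) (f Q) = dist P Q) /\
    [/\ f A = A', f B = B' & f C = C'].
Proof.
case: A B C A' B' C' => [a1 a2] [b1 b2] [c1 c2] [a1' a2'] [b1' b2'] [c1' c2'] nd AB BC CA.
have := dist_sqr (a1, a2) (b1, b2); have := dist_sqr (b1, b2) (c1, c2).
have := dist_sqr (c1, c2) (a1, a2).
rewrite AB BC CA !dist_sqr /=.
pose u1 := b1 - a1; pose u2 := b2 - a2; pose v1 := c1 - a1; pose v2 := c2 - a2.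
pose u1' := b1' - a1'; pose u2' := b2' - a2'; pose v1' := c1' - a1'; pose v2' := c2' - a2'.
move=> hCA hBC hAB.
have uu : u1' ^+ 2 + u2' ^+ 2 = u1 ^+ 2 + u2 ^+ 2 by rewrite /u1' /u2' /u1 /u2; lra.
have vv : v1' ^+ 2 + v2' ^+ 2 = v1 ^+ 2 + v2 ^+ 2 by rewrite /v1' /v2' /v1 /v2; lra.
have uv : u1' * v1' + u2' * v2' = u1 * v1 + u2 * v2.
  by rewrite /u1' /u2' /u1 /u2 /v1' /v2' /v1 /v2; lra.
pose D := u1 * v2 - u2 * v1; pose D' := u1' * v2' - u2' * v1'.
have DD : D' ^+ 2 = D ^+ 2.
  have E (x1 x2 y1 y2 : R) : (x1 * y2 - x2 * y1) ^+ 2 =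
    (x1 ^+ 2 + x2 ^+ 2) * (y1 ^+ 2 + y2 ^+ 2) - (x1 * y1 + x2 * y2) ^+ 2 by ring.
  by rewrite !E uu vv uv.
have D0 : D != 0.
  apply: contraNneq nd => D0; rewrite /area /=.
  have -> : (b1 - a1) * (c2 - a2) - (c1 - a1) * (b2 - a2) = D by rewrite /D /u1 /u2 /v1 /v2; ring.
  by rewrite D0 normr0 mul0r.
pose N := u1 ^+ 2 + u2 ^+ 2.
have N0 : N != 0.
  apply: contraNneq D0 => /eqP; rewrite paddr_eq0 ?sqr_ge0 // !sqrf_eq0 => /andP[/eqP h1 /eqP h2].
  by rewrite /D h1 h2 !mul0r subrr.
(* The sign e records whether the isometry reverses orientation. The map f takes the coordinates of
   P - A along u = B - A and its quarter turn to those along B' - A', with sign e on the second. *)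
pose e := D' / D.
have e2 : e ^+ 2 = 1 by rewrite /e expr_div_n DD divff // sqrf_eq0.
pose f (P : R * R) : R * R :=
  let: p := (P.1 - a1) * u1 + (P.2 - a2) * u2 in
  let: q := e * ((P.2 - a2) * u1 - (P.1 - a1) * u2) in
  (a1' + (p * u1' - q * u2') / N, a2' + (p * u2' + q * u1') / N).
exists f; split.
  move=> [p1 p2] [q1 q2]; rewrite /dist /f /=; congr Num.sqrt.
  have G (x y : R) : ((x * u1' - y * u2') / N) ^+ 2 + ((x * u2' + y * u1') / N) ^+ 2
     = (x ^+ 2 + y ^+ 2) / N.
    have -> : ((x * u1' - y * u2') / N) ^+ 2 + ((x * u2' + y * u1') / N) ^+ 2 =
      (x ^+ 2 + y ^+ 2) * (u1' ^+ 2 + u2' ^+ 2) / N ^+ 2 by field.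
    by rewrite uu -/N; field.
  transitivity ((((p1 - q1) * u1 + (p2 - q2) * u2) ^+ 2 +
    (e * ((p2 - q2) * u1 - (p1 - q1) * u2)) ^+ 2) / N).
    by rewrite -G; congr (_ ^+ 2 + _ ^+ 2); field.
  have -> : (e * ((p2 - q2) * u1 - (p1 - q1) * u2)) ^+ 2 =
    ((p2 - q2) * u1 - (p1 - q1) * u2) ^+ 2 by rewrite exprMn e2 mul1r.
  have -> : ((p1 - q1) * u1 + (p2 - q2) * u2) ^+ 2 +
    ((p2 - q2) * u1 - (p1 - q1) * u2) ^+ 2 =
    ((p1 - q1) ^+ 2 + (p2 - q2) ^+ 2) * N by rewrite /N; ring.
  by rewrite mulfK.
split; rewrite /f /=.
- by rewrite !subrr !mul0r subrr addr0 mulr0 !mul0r subrr addr0 mul0r !addr0.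
- rewrite -/u1 -/u2.
  have -> : u1 * u1 + u2 * u2 = N by rewrite /N; ring.
  have -> : e * (u2 * u1 - u1 * u2) = 0 by ring.
  by congr pair; rewrite /u1' /u2'; field.
- rewrite -/v1 -/v2.
  have -> : e * (v2 * u1 - v1 * u2) = D'.
    by rewrite -[RHS](divfK D0) -/e /D; ring.
  have -> : v1 * u1 + v2 * u2 = u1' * v1' + u2' * v2' by rewrite uv; ring.
  congr pair.
    have -> : (u1' * v1' + u2' * v2') * u1' - D' * u2' =
      v1' * (u1' ^+ 2 + u2' ^+ 2) by rewrite /D'; ring.
    by rewrite uu -/N mulfK // /v1'; ring.
  have -> : (u1' * v1' + u2' * v2') * u2' + D' * u1' =
    v2' * (u1' ^+ 2 + u2' ^+ 2) by rewrite /D'; ring.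
  by rewrite uu -/N mulfK // /v2'; ring.
Qed.

Lemma perm_eq2 (T : eqType) (a b c d : T) : perm_eq [:: a; b] [:: c; d] ->
  (a = c /\ b = d) \/ (a = d /\ b = c).
Proof.
move=> h; have : a \in [:: c; d] by rewrite -(perm_mem h) mem_head.
rewrite !inE => /orP[] /eqP ac; subst a.
  move: h; rewrite perm_cons => h.
  by have [->] := @perm_small_eq _ [:: b] [:: d] isT h; left.
have : perm_eq [:: d; b] [:: d; c] by rewrite (perm_trans h) // (perm_catC [:: c] [:: d]).
rewrite perm_cons => h'.
by have [->] := @perm_small_eq _ [:: b] [:: c] isT h'; right.
Qed.

Lemma perm_eq3 (T : eqType) (x1 x2 x3 y1 y2 y3 : T) :
  perm_eq [:: x1; x2; x3] [:: y1; y2; y3] ->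
  [\/ x1 = y1 /\ perm_eq [:: x2; x3] [:: y2; y3],
      x1 = y2 /\ perm_eq [:: x2; x3] [:: y1; y3]
    | x1 = y3 /\ perm_eq [:: x2; x3] [:: y1; y2]].
Proof.
move=> h; have : x1 \in [:: y1; y2; y3] by rewrite -(perm_mem h) mem_head.
rewrite !inE => /or3P[] /eqP e; subst x1.
- by apply: Or31; split=> //; rewrite -(perm_cons y1).
- apply: Or32; split=> //; rewrite -(perm_cons y2) (perm_trans h) //.
  by rewrite (perm_catCA [:: y1] [:: y2]).
- apply: Or33; split=> //; rewrite -(perm_cons y3) (perm_trans h) //.
  by rewrite (perm_catC [:: y1; y2] [:: y3]).
Qed.

Lemma congruent_of_sides (R : realType) (T U : triangle R) : area T != 0 ->
  perm_eq (side_lengths T) (side_lengths U) -> congruent T U.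
Proof.
case: T U => [A B C] [A' B' C'] nd.
have cg X Y Z : perm_eq [:: X; Y; Z] [:: A'; B'; C'] ->
    dist B C = dist Y Z -> dist C A = dist Z X -> dist A B = dist X Y ->
    congruent (Triangle A B C) (Triangle A' B' C').
  move=> pV BC CA AB.
  have [f [fd [fA fB fC]]] := congruent_vertices nd AB BC CA.
  by exists f; split; rewrite // /vertices /= fA fB fC.
rewrite /side_lengths /= => /perm_eq3[] [BC] /perm_eq2[] [CA AB].
- by apply: (cg A' B' C'); [apply/permP => p /=; lia | | |]; rewrite ?BC ?CA ?AB // distC.
- by apply: (cg A' C' B'); [apply/permP => p /=; lia | | |]; rewrite ?BC ?CA ?AB // distC.
- by apply: (cg B' A' C'); [apply/permP => p /=; lia | | |]; rewrite ?BC ?CA ?AB // distC.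
- by apply: (cg B' C' A'); [apply/permP => p /=; lia | | |]; rewrite ?BC ?CA ?AB // distC.
- by apply: (cg C' A' B'); [apply/permP => p /=; lia | | |]; rewrite ?BC ?CA ?AB // distC.
- by apply: (cg C' B' A'); [apply/permP => p /=; lia | | |]; rewrite ?BC ?CA ?AB // distC.
Qed.

Lemma sort3 (x y z : nat) : exists x' y' z', [/\ (x' <= y' <= z')%N,
  (x' + y' + z' = x + y + z)%N, (x' * y' * z' = x * y * z)%N,
  (0 < x')%N = (0 < x)%N && (0 < y)%N && (0 < z)%N &
  perm_eq [:: y + z; x + z; x + y]%N [:: y' + z'; x' + z'; x' + y']%N].
Proof.
have ok u v w : (u <= v <= w)%N -> (u + v + w = x + y + z)%N -> (u * v * w = x * y * z)%N ->
  perm_eq [:: y + z; x + z; x + y]%N [:: v + w; u + w; u + v]%N ->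
  exists x' y' z', [/\ (x' <= y' <= z')%N,
  (x' + y' + z' = x + y + z)%N, (x' * y' * z' = x * y * z)%N,
  (0 < x')%N = (0 < x)%N && (0 < y)%N && (0 < z)%N &
  perm_eq [:: y + z; x + z; x + y]%N [:: y' + z'; x' + z'; x' + y']%N].
  move=> uvw s p pe; exists u, v, w; split=> //.
  have : (0 < u * v * w)%N = (0 < x * y * z)%N by rewrite p.
  by rewrite !muln_gt0; lia.
have pe3 (a b c a' b' c' : nat) : 
    (forall p : pred nat, p a + (p b + (p c + 0)) = p a' + (p b' + (p c' + 0)))%N ->
    perm_eq [:: a; b; c] [:: a'; b'; c'].
  by move=> h; apply/permP => p; apply: h.
have [xy|xy] := leqP x y; have [yz|yz] := leqP y z; have [xz|xz] := leqP x z.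
- by apply: (ok x y z); [lia | lia | lia |];
  apply: pe3 => p; rewrite ?(addnC y x) ?(addnC z x) ?(addnC z y); lia.
- lia.
- by apply: (ok x z y); [lia | lia | lia |];
  apply: pe3 => p; rewrite ?(addnC y x) ?(addnC z x) ?(addnC z y); lia.
- by apply: (ok z x y); [lia | lia | lia |];
  apply: pe3 => p; rewrite ?(addnC y x) ?(addnC z x) ?(addnC z y); lia.
- by apply: (ok y x z); [lia | lia | lia |];
  apply: pe3 => p; rewrite ?(addnC y x) ?(addnC z x) ?(addnC z y); lia.
- by apply: (ok y z x); [lia | lia | lia |];
  apply: pe3 => p; rewrite ?(addnC y x) ?(addnC z x) ?(addnC z y); lia.
- lia.
- by apply: (ok z y x); [lia | lia | lia |];
  apply: pe3 => p; rewrite ?(addnC y x) ?(addnC z x) ?(addnC z y); lia.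
Qed.

(** * From sociable cycles to steps between integers *)

(** Modulo 3 the product x y z (x + y + z) is 0 or 2, so it is a square only when it is 0. *)
Lemma dvd3_area x y z m : (m * m = x * y * z * (x + y + z))%N -> (3 %| m)%N.
Proof.
have d3 n : (n = 3 * (n %/ 3) \/ n = 3 * (n %/ 3) + 1 \/ n = 3 * (n %/ 3) + 2)%N by lia.
move=> h; suff : (m %% 3 = 0)%N by move=> /eqP.
case: (sq_mod3 m) => [[_ //]|[m1 _]]; exfalso; move: h m1 => ->.
move: (x %/ 3)%N (y %/ 3)%N (z %/ 3)%N (d3 x) (d3 y) (d3 z) => a b c.
by case=> [->|[->|->]]; case=> [->|[->|->]]; case=> [->|[->|->]]; lia.
Qed.

Lemma sociable_cycle_edges (R : realType) n (H : 'I_n -> triangle R) :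
  sociable_cycle H -> exists f : 'I_n -> nat, forall i,
  [/\ perimeter (H i) = (6 * f i)%:R, area (H i) = (6 * f (ordS i))%:R
    & exists x y z : nat, [/\ (0 < x)%N, (x <= y <= z)%N, (x + y + z = 3 * f i)%N,
        (x * y * z * f i = 12 * (f (ordS i) * f (ordS i)))%N
      & has_sides (H i) (y + z)%:R (x + z)%:R (x + y)%:R]].
Proof.
case=> her _ AP.
have perE i x y z : side_lengths (H i) = [:: (y + z)%:R; (x + z)%:R; (x + y)%:R] ->
    perimeter (H i) = (2 * (x + y + z))%:R.
  move=> sE; rewrite /perimeter sE !big_cons big_nil addr0 -!natrD.
  by congr (_%:R); lia.
(* A perimeter 2 (x + y + z) is even, and it is the area of the preceding triangle, hence divisible
   by 3. *)
have per6 i : exists k : nat, perimeter (H i) = (6 * k)%:R.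
  have [x [y [z [_ [/perE pE _ _ _]]]]] := heronian_nat (her i).
  have [x' [y' [z' [m [_ aE _ /dvd3_area /dvdnP[k mE]]]]]] := heronian_nat (her (ord_pred i)).
  have : (2 * (x + y + z) = m)%N.
    by apply/eqP; rewrite -(eqr_nat R) -pE -aE AP ord_predK.
  by move=> e; exists (k %/ 2)%N; rewrite pE; congr (_%:R); lia.
pose f i := (Num.truncn (perimeter (H i)) %/ 6)%N.
have fE i : perimeter (H i) = (6 * f i)%:R.
  by have [k kE] := per6 i; rewrite /f kE natrK mulKn.
exists f => i; split=> //; first by rewrite AP fE.
have [x [y [z [m [sE aE xyz0 mE]]]]] := heronian_nat (her i).
have [x' [y' [z' [le' sum' prod' pos' pe]]]] := sort3 x y z.
have s3 : (x + y + z = 3 * f i)%N.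
  have : (2 * (x + y + z) = 6 * f i)%N by apply/eqP; rewrite -(eqr_nat R) -(perE _ _ _ _ sE) fE.
  by lia.
have m6 : (m = 6 * f (ordS i))%N by apply/eqP; rewrite -(eqr_nat R) -aE AP fE.
exists x', y', z'; split=> //.
- by rewrite pos' xyz0.
- by rewrite sum'.
- by rewrite prod'; move: mE; rewrite s3 m6; clear; lia.
- by rewrite /has_sides sE; apply: (perm_map (fun k : nat => k%:R) pe).
Qed.

Lemma sociable_cycle_cases (R : realType) n (H : 'I_n -> triangle R) :
  sociable_cycle H -> exists f : 'I_n -> nat, forall i,
  [/\ perimeter (H i) = (6 * f i)%:R, area (H i) = (6 * f (ordS i))%:R &
    [\/ [/\ f i = 6, f (ordS i) = 9 & has_sides (H i) 9 12 15]%N,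
        [/\ f i = 9, f (ordS i) = 6 & has_sides (H i) 3 25 26]%N
      | [/\ f i = 6, f (ordS i) = 6 & has_sides (H i) 9 10 17]%N]].
Proof.
move=> cyc; have [f fP] := sociable_cycle_edges cyc; exists f => i.
have [pE aE [x [y [z [x0 xyz sum prod sides]]]]] := fP i.
split=> //; have f69 k : f k \in [:: 6; 9].
  rewrite !inE; suff [->|->] : f k = 6 \/ f k = 9 by [].
  apply: (edge_cycle (f := f)) => [j|].
    by have [_ _ [u [v [w [? ? ? ? _]]]]] := fP j; exists u, v, w.
  have [_ [j ne] _] := cyc; exists j => fj; apply: ne.
  by rewrite /equable; have [-> -> _] := fP j; rewrite fj.
have := edge_triangle (f69 i) (f69 (ordS i)) x0 xyz sum prod.
rewrite !inE => /or3P[] /eqP[-> -> xE yE zE]; subst x y z.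
- apply: Or33; split=> //; apply: (perm_trans sides).
  exact: (@perm_map _ _ (fun k : nat => k%:R) [:: 17; 10; 9] [:: 9; 10; 17]%N).
- apply: Or31; split=> //; apply: (perm_trans sides).
  exact: (@perm_map _ _ (fun k : nat => k%:R) [:: 15; 12; 9] [:: 9; 12; 15]%N).
- apply: Or32; split=> //; apply: (perm_trans sides).
  exact: (@perm_map _ _ (fun k : nat => k%:R) [:: 26; 25; 3] [:: 3; 25; 26]%N).
Qed.

(** * Explicit triangles and the classification *)

Lemma has_sides_perimeter (R : realType) (T : triangle R) a b c :
  has_sides T a b c -> perimeter T = a + b + c.
Proof.
by move=> h; rewrite /perimeter (perm_big _ h) /= !big_cons big_nil addr0 addrA.
Qed.

Lemma int_triangle (R : realType) (T : triangle R) (a b c m : nat) :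
  dist (vertB T) (vertC T) = a%:R -> dist (vertC T) (vertA T) = b%:R ->
  dist (vertA T) (vertB T) = c%:R -> area T = m.+1%:R ->
  [/\ heronian T, area T = m.+1%:R, perimeter T = (a + b + c)%:R & has_sides T a%:R b%:R c%:R].
Proof.
move=> BC CA AB aE; split=> //.
- split; first by rewrite /Defs.nondegenerate aE pnatr_eq0.
  + by move=> l; rewrite /side_lengths /= BC CA AB !inE => /or3P[] /eqP ->; apply: intr_nat.
  + by rewrite aE intr_nat.
- by rewrite perimeterE /= BC CA AB !natrD.
- by rewrite /has_sides /side_lengths /= BC CA AB.
Qed.

Lemma triangle_3_25_26 (R : realType) : exists T : triangle R,
  [/\ heronian T, area T = 36, perimeter T = 54 & has_sides T 3 25 26].
Proof.
exists (Triangle (10, 24) (0, 0) (3, 0)).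
apply: (@int_triangle R (Triangle (10, 24) (0, 0) (3, 0)) 3 25 26 35);
  try by apply: dist_nat => /=; ring.
by rewrite /area /= ger0_norm; lra.
Qed.

Lemma triangle_9_12_15 (R : realType) : exists T : triangle R,
  [/\ heronian T, area T = 54 & perimeter T = 36].
Proof.
exists (Triangle (0, 12) (0, 0) (9, 0)).
have [] // := @int_triangle R (Triangle (0, 12) (0, 0) (9, 0)) 9 15 12 53;
  try by apply: dist_nat => /=; ring.
by rewrite /area /= ger0_norm; lra.
Qed.

Lemma triangle_9_10_17 (R : realType) : exists T : triangle R,
  [/\ heronian T, area T = 36 & perimeter T = 36].
Proof.
exists (Triangle (- 6, 8) (0, 0) (9, 0)).
have [] // := @int_triangle R (Triangle (- 6, 8) (0, 0) (9, 0)) 9 17 10 35;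
  try by apply: dist_nat => /=; ring.
by rewrite /area /= ger0_norm; lra.
Qed.

Lemma sociable_cycle_exists (R : realType) n (hn : (2 <= n)%N) : exists H : triangle R,
  [/\ in_sociable_cycle n H, area H < perimeter H & has_sides H 3 25 26].
Proof.
have [T [Th Ta Tp Ts]] := triangle_3_25_26 R.
have [U [Uh Ua Up]] := triangle_9_12_15 R.
have [V [Vh Va Vp]] := triangle_9_10_17 R.
exists T; split=> //; last by rewrite Ta Tp ltr_nat.
case: n hn => [|[|n]] // _.
(* The amicable pair occupies the last and first positions, and equable copies of (9, 10, 17) fill
   the n - 2 places between. *)
pose H (i : 'I_n.+2) := if i == ord0 then T else if i == ord_max then U else V.
exists H; split; last by exists ord0; rewrite /H eqxx.
split.
- by move=> i; rewrite /H; case: ifP => _ //; case: ifP.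
- exists ord0; rewrite /H eqxx /equable Ta Tp => /eqP; by rewrite eqr_nat.
move=> i; rewrite /H.
have [->|i0] := eqVneq i ord0.
  have -> : (ordS ord0 == ord0 :> 'I_n.+2) = false by [].
  by rewrite Ta; case: ifP.
have [->|im] := eqVneq i ord_max.
  have -> : (ordS ord_max == ord0 :> 'I_n.+2) by rewrite -val_eqE /= modnn.
  by rewrite Ua Tp.
have iS : ordS i = i.+1 :> nat.
  rewrite /= modn_small // ltn_neqAle ltn_ord andbT.
  by apply: contra im => /eqP h; rewrite -val_eqE /=; apply/eqP; case: h.
have -> : (ordS i == ord0) = false by apply/eqP => /(congr1 val); rewrite [val _]iS.
by rewrite Va; case: ifP.
Qed.

Theorem theorem3 (R : realType) (n : nat) (hn : (2 <= n)%N) :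
  (exists H : triangle R,
     [/\ in_sociable_cycle n H,
         area H < perimeter H,
         has_sides H 3 25 26
       & forall K : triangle R, in_sociable_cycle n K ->
           area K < perimeter K -> congruent K H])
  /\
  (forall H : 'I_n -> triangle R, sociable_cycle H ->
     (forall i, [\/ has_sides (H i) 9 12 15,
                    has_sides (H i) 3 25 26
                  | has_sides (H i) 9 10 17])
     /\
     (forall i, has_sides (H i) 9 12 15 <-> has_sides (H (ordS i)) 3 25 26)).
Proof.
split.
  have [T [Tc Ta Ts]] := sociable_cycle_exists R hn; exists T; split=> // K [H [cyc [i <-]]].
  have [f /(_ i)[-> aE c]] := sociable_cycle_cases cyc.
  rewrite aE ltr_nat; case: c => -[-> -> Ks] // _.
  apply: congruent_of_sides; last by rewrite (perm_trans Ks) // perm_sym.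
  by have [/(_ i)[]] := cyc.
move=> H cyc; have [f fP] := sociable_cycle_cases cyc; split=> i.
  have [_ _ [[_ _ h]|[_ _ h]|[_ _ h]]] := fP i; by [apply: Or31|apply: Or32|apply: Or33].
have [pi _ ci] := fP i; have [pj _ cj] := fP (ordS i); split=> h.
- have fi : f i = 6%N.
    move: pi; rewrite (has_sides_perimeter h) => /eqP.
    by rewrite -!natrD eqr_nat => /eqP; lia.
  have fj : f (ordS i) = 9%N.
    case: ci => -[fi' fj' hs]; [by [] | by move: fi'; rewrite fi |].
    (* Both (9, 12, 15) and (9, 10, 17) have perimeter 36; the side 12 tells them apart. *)
    have pe : perm_eq [:: 9; 12; 15 : R] [:: 9; 10; 17].
      by rewrite -(permPl h).
    by have := perm_mem pe 12; rewrite !inE !eqr_nat.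
  by case: cj => -[] //; rewrite fj.
- have fj : f (ordS i) = 9%N.
    move: pj; rewrite (has_sides_perimeter h) => /eqP.
    by rewrite -!natrD eqr_nat => /eqP; lia.
  by case: ci => -[] // _; rewrite fj.
Qed.
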